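(* Let $q\ge 2$ be any integer and let $n,d$ be any integers with $2\le d\le \frac{n+1}{2}$. Then there exists a polynomial of the form $$W(x,y)=x^n+\sum_{i=d}^n A_i x^{n-i}y^i\qquad (A_i\in\mathbf{C},\ A_d\neq 0)$$ which is $\sigma_q$-invariant, i.e. $W^{\sigma_q}(x,y)=W(x,y)$, and which satisfies the Riemann hypothesis (with respect to $q$).
   Context: MacWilliams transform: $\sigma_q=\frac{1}{\sqrt q}\begin{pmatrix}1&q-1\\1&-1\end{pmatrix}$. For $f(x,y)\in\mathbf{C}[x,y]$ and a matrix $\sigma=\begin{pmatrix}a&b\\c&e\end{pmatrix}$, put $f^{\sigma}(x,y)=f(ax+by,cx+ey)$. Zeta polynomial: for an integer $q\ge 2$ and a homogeneous polynomial $W(x,y)=x^n+\sum_{i=d}^n A_i x^{n-i}y^i$ ($A_i\in\mathbf{C}$, $A_d\ne0$), the zeta polynomial $P(T)\in\mathbf{C}[T]$ of $W$ is the unique polynomial of degree at most $n-d$ such that the coefficient of $T^{n-d}$ in the power series expansion in $T$ of $$\frac{P(T)}{(1-T)(1-qT)}\,(y(1-T)+xT)^n$$ equals $\dfrac{W(x,y)-x^n}{q-1}$. (Such a polynomial exists and is unique.) Riemann hypothesis: a $\sigma_q$-invariant polynomial $W(x,y)$ satisfies the Riemann hypothesis if all the zeros of its zeta polynomial $P(T)$ have the same absolute value $1/\sqrt q$. *)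

(* Defs.v *)
From HB Require Import structures.
From mathcomp Require Import all_boot all_order all_algebra.
From mathcomp Require Import reals complex.
From mathcomp Require Import mpoly.

Set Implicit Arguments.
Unset Strict Implicit.
Unset Printing Implicit Defensive.

Import Order.TTheory GRing.Theory Num.Theory.
Local Open Scope ring_scope.

Section PowerSeriesQuotient.
Variable A : comUnitRingType.
Implicit Types N D : {poly A}.

(* Long division by increasing powers of T: the first m coefficients of the
   power series N / D, for D with invertible constant coefficient. *)
Fixpoint series_coefs N D (m : nat) : seq A :=
  if m is m'.+1 then
    let s := series_coefs N D m' in
    rcons s ((D`_0)^-1 * (N`_m' - \sum_(i < m') s`_i * D`_(m' - i)))
  else [::].

Definition series_coef N D (m : nat) : A := (series_coefs N D m.+1)`_m.

Lemma size_series_coefs N D m : size (series_coefs N D m) = m.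
Proof. by elim: m => //= m IHm; rewrite size_rcons IHm. Qed.

Lemma nth_series_coefs N D m i :
  (i < m)%N -> (series_coefs N D m)`_i = series_coef N D i.
Proof.
elim: m => // m IHm; rewrite ltnS leq_eqVlt => /predU1P[-> //|ltim].
by rewrite -IHm //= nth_rcons size_series_coefs ltim.
Qed.

(* The series S = \sum_m (series_coef N D m) T^m satisfies S * D = N. *)
Lemma series_coefP N D m : D`_0 \is a GRing.unit ->
  \sum_(i < m.+1) series_coef N D i * D`_(m - i) = N`_m.
Proof.
move=> uD; rewrite big_ord_recr /= subnn.
rewrite {2}/series_coef /= nth_rcons size_series_coefs ltnn eqxx.
rewrite mulrC mulVKr // addrC.
under eq_bigr => i _ do rewrite nth_series_coefs //.
by rewrite subrK.
Qed.

End PowerSeriesQuotient.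

Section ZetaPolynomials.
Variable C : numClosedFieldType.
Implicit Types (q n d : nat) (W : {mpoly C[2]}) (P : {poly C}).

Definition x : {mpoly C[2]} := 'X_ord0.
Definition y : {mpoly C[2]} := 'X_ord_max.

Definition sigma q : 'M[C]_2 :=
  (sqrtC q%:R)^-1 *:
    \matrix_(i < 2, j < 2)
      (if i == ord0 then if j == ord0 then 1 else q%:R - 1
       else if j == ord0 then 1 else - 1).

(* f(x, y) |-> f(a x + b y, c x + e y) for M with rows (a, b) and (c, e) *)
Definition act W (M : 'M[C]_2) : {mpoly C[2]} :=
  W \mPo [tuple M i ord0 *: x + M i ord_max *: y | i < 2].

Definition weight_poly n d (A : nat -> C) : {mpoly C[2]} :=
  x ^+ n + \sum_(d <= i < n.+1) A i *: (x ^+ (n - i) * y ^+ i).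

(* Here 'X is the variable T, over the coefficient ring C[x, y]. *)
Definition zeta_num n P : {poly {mpoly C[2]}} :=
  map_poly (@mpolyC 2 C) P * (y%:P * (1 - 'X) + x%:P * 'X) ^+ n.

Definition zeta_den q : {poly {mpoly C[2]}} :=
  (1 - 'X) * (1 - q%:R * 'X).

Definition is_zeta_poly q n d W P : Prop :=
  (size P <= (n - d).+1)%N /\
  series_coef (zeta_num n P) (zeta_den q) (n - d)
    = (q%:R - 1)^-1 *: (W - x ^+ n).

(* For W = weight_poly n d A with d <= n and 1 < q there is exactly one P with
   is_zeta_poly q n d W P, so the existential below merely names it. *)
Definition riemann_hypothesis q n d W : Prop :=
  exists P, is_zeta_poly q n d W P /\
    (forall z : C, root P z -> `|z| = (sqrtC q%:R)^-1).

End ZetaPolynomials.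

(* Main.v *)
Require Import Defs.
From mathcomp Require Import all_boot all_order all_algebra.
From mathcomp Require Import reals complex.
From mathcomp Require Import mpoly.
From mathcomp Require Import ring zify.

(** Put s = sqrt q.  The theorem holds because one can prescribe the zeta
    polynomial: take P(T) = ((1 + s T) / (1 + s)) ^ r with r = n + 2 - 2 d,
    whose only zero is - 1 / s, and let W be the weight polynomial that it determines,
      W = x ^ n + (q - 1) [T ^ (n - d)] N(T) / ((1 - T) (1 - q T)),
      N(T) = P(T) (y (1 - T) + x T) ^ n.
    The power of T that accompanies x ^ (n - i) y ^ i in N is at least n - i, so
    the coefficient in T ^ (n - d) only involves i >= d, and the coefficient of
    x ^ (n - d) y ^ d is a nonzero multiple of P(0) ([zeta_coef_weight_poly]).
    The degree of P is at most n - d because d >= 2.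

    The content is the invariance of W ([act_circle_weight]).  Let u and v be
    the images of x and y under sigma_q.  Then x = y + s v, u = v + s y, and
    sigma_q maps v back to y.  Up to the factor (1 + s) ^ (- r), the numerator
    N(T) is p(s T), where
      p(t) = (1 + t) ^ r (y + v t) ^ n,
    and sigma_q exchanges y and v, so it turns p into
      p'(t) = (1 + t) ^ r (v + y t) ^ n,
    the polynomial p with its coefficients in reverse order.  Both have degree
    at most r + n = 2 m, where m = n - d + 1.  Since the coefficient in T ^ j of
    (q - 1) / ((1 - T) (1 - q T)) is q ^ (j + 1) - 1, the coefficient of
    T ^ (n - d) in (q - 1) p(s T) / ((1 - T) (1 - q T)) is the sum over k < m of
      p_k (s ^ (2 m - k) - s ^ k).
    In the difference of this sum and the same sum for p', the relation
    p'_k = p_(2 m - k) completes the range of k to 0 .. 2 m, and the difference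
    is p'(s) - p(s) ([reciprocal_sumB]), that is
      (1 + s) ^ r ((v + y s) ^ n - (y + v s) ^ n) = (1 + s) ^ r (u ^ n - x ^ n).
    Hence W and its image differ by x ^ n - u ^ n + (u ^ n - x ^ n) = 0. *)

Set Implicit Arguments.
Unset Strict Implicit.
Unset Printing Implicit Defensive.

Local Open Scope ring_scope.
Import Order.TTheory GRing.Theory Num.Theory.

(** * Power series division by the zeta denominator *)

(** The coefficients of N H satisfy, up to index m, the triangular system with
    invertible diagonal that defines those of N / D.  This turns the
    coefficients of a quotient series into those of a product of polynomials. *)
Lemma series_coef_truncated_inv (A : comUnitRingType) (N D H E : {poly A})
    (m : nat) :
  D`_0 \is a GRing.unit -> D * H = 1 + E * 'X^(m.+1) ->
  series_coef N D m = (N * H)`_m.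
Proof.
move=> uD defH.
suff: forall k, (k <= m)%N -> series_coef N D k = (N * H)`_k by apply.
elim/ltn_ind => k IHk lekm.
have: \sum_(i < k.+1) (N * H)`_i * D`_(k - i) = N`_k.
  rewrite -coefM -mulrA (mulrC H) defH mulrDr mulr1 coefD mulrA coefMXn.
  by rewrite ltnS lekm addr0.
rewrite -(series_coefP N k uD) !big_ord_recr /= subnn.
under eq_bigr => i _ do rewrite -IHk ?(ltnW (leq_trans (ltn_ord i) lekm)) //.
by move=> /addrI /(mulIr uD) ->.
Qed.

Definition geom {A : comNzRingType} (a : A) (m : nat) : {poly A} :=
  \poly_(i < m.+1) a ^+ i.

Lemma mul_geom (A : comNzRingType) (a : A) (m : nat) :
  (1 - a%:P * 'X) * geom a m = 1 - (a ^+ m.+1)%:P * 'X^(m.+1).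
Proof.
have -> : geom a m = \sum_(i < m.+1) (a%:P * 'X) ^+ i.
  rewrite /geom poly_def; apply: eq_bigr => i _.
  by rewrite exprMn -polyC_exp mul_polyC.
by rewrite -opprB mulNr -subrX1 opprB exprMn -polyC_exp.
Qed.

(** Multiplying by a - 1, rather than dividing, gives the partial geometric
    sums a closed form over any ring. *)
Lemma coef_geomM (A : comNzRingType) (a : A) (m k : nat) : (k <= m)%N ->
  (a - 1) * (geom a m * geom 1 m)`_k = a ^+ k.+1 - 1.
Proof.
move=> lekm; rewrite coefM subrX1; congr (_ * _).
apply: eq_bigr => -[i /= ltik] _.
rewrite !coef_poly expr1n.
by rewrite (leq_trans ltik) // ltnS (leq_trans (leq_subr _ _) lekm) mulr1.
Qed.

Lemma map_geom (A B : comNzRingType) (f : {rmorphism A -> B}) (a : A) m :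
  map_poly f (geom a m) = geom (f a) m.
Proof.
apply/polyP => i; rewrite coef_map !coef_poly.
by case: ifP => _ /=; rewrite ?rmorphXn ?rmorph0.
Qed.

(** Each geometric sum inverts one linear factor modulo T ^ (m + 1), so their
    product is a polynomial truncation of the series 1 / ((1 - T) (1 - q T)). *)
Lemma zeta_den_inv (A : comNzRingType) (q m : nat) :
  (1 - 'X) * (1 - q%:R * 'X) * (geom q%:R m * geom 1 m) =
  1 + (((q%:R ^+ m.+1)%:P * ('X^(m.+1) - 1) - 1) : {poly A}) * 'X^(m.+1).
Proof.
have G1 := mul_geom (1 : A) m; have Gq := mul_geom (q%:R : A) m.
rewrite polyC_natr in Gq; rewrite expr1n polyC1 !mul1r in G1.
transitivity (((1 - 'X) * geom 1 m) * ((1 - q%:R * 'X) * geom (q%:R : A) m)).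
  by ring.
by rewrite G1 Gq; ring.
Qed.

(** * Reciprocal polynomials *)

(** The formal degree m is a parameter because p and p' may have a zero leading
    coefficient; p' is then t ^ m p(1 / t). *)
Definition reciprocal {A : comNzRingType} (m : nat) (p p' : {poly A}) : Prop :=
  [/\ (size p <= m.+1)%N, (size p' <= m.+1)%N
    & forall i j, (i + j)%N = m -> p`_i = p'`_j].

Lemma size_mul_linear (A : comNzRingType) (m : nat) (p : {poly A}) (a b : A) :
  (size p <= m.+1)%N -> (size (p * (a%:P + b%:P * 'X))%R <= m.+2)%N.
Proof.
move=> szp; apply: leq_trans (size_polyMleq _ _) _.
have : (size (a%:P + b%:P * 'X)%R <= 2)%N.
  by rewrite addrC -cons_poly_def size_cons_poly; case: ifP => // _;
    rewrite ltnS size_polyC_leq1.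
lia.
Qed.

Lemma coef_mul_linear (A : comNzRingType) (p : {poly A}) (a b : A) k :
  (p * (a%:P + b%:P * 'X))`_k = p`_k * a + (if k == 0 then 0 else p`_k.-1 * b).
Proof. by rewrite mulrDr coefD coefMC mulrA coefMX coefMC. Qed.

Lemma reciprocal_mul (A : comNzRingType) (m : nat) (p p' : {poly A}) (a b : A) :
  reciprocal m p p' ->
  reciprocal m.+1 (p * (a%:P + b%:P * 'X)) (p' * (b%:P + a%:P * 'X)).
Proof.
case=> szp szp' rpp'; split; [exact: size_mul_linear.. | move=> i j Dm].
rewrite !coef_mul_linear.
case: i j Dm => [|i] [|j] //= Dm.
- have -> : j = m by lia.
  by rewrite addr0 (nth_default 0 szp') mul0r add0r (rpp' 0 m).
- have -> : i = m by lia.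
  by rewrite addr0 (nth_default 0 szp) mul0r add0r (rpp' m 0) ?addn0.
- by rewrite (rpp' i.+1 j) ?(rpp' i j.+1) 1?addrC //; lia.
Qed.

(** For the zeta polynomial chosen below, the numerator of the generating series
    in the variable t = s T, up to a constant factor. *)
Definition rescaled_num {A : comNzRingType} (r n : nat) (a b : A) : {poly A} :=
  (1 + 'X) ^+ r * (a%:P + b%:P * 'X) ^+ n.

(** Reversal is multiplicative: it fixes 1 + t and exchanges a + b t with
    b + a t. *)
Lemma reciprocal_rescaled_num (A : comNzRingType) r n (a b : A) :
  reciprocal (r + n) (rescaled_num r n a b) (rescaled_num r n b a).
Proof.
elim: n => [|n IHn].
  rewrite addn0 /rescaled_num !expr0 !mulr1; elim: r => [|r IHr].
    by split; rewrite ?expr0 ?size_poly1 // => -[] // [].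
  have -> : 1 + 'X = 1%:P + 1%:P * 'X :> {poly A} by rewrite polyC1 mul1r.
  rewrite exprSr; apply: reciprocal_mul; move: IHr.
  by rewrite polyC1 mul1r.
by rewrite addnS /rescaled_num !exprSr !mulrA; apply: reciprocal_mul.
Qed.

Lemma map_rescaled_num (A B : comNzRingType) (f : {rmorphism A -> B}) r n
    (a b : A) :
  map_poly f (rescaled_num r n a b) = rescaled_num r n (f a) (f b).
Proof.
rewrite /rescaled_num rmorphM !rmorphXn !rmorphD rmorph1 rmorphM /= map_polyX.
by rewrite !map_polyC.
Qed.

Lemma horner_rescaled_num (A : comNzRingType) r n (a b s : A) :
  (rescaled_num r n a b).[s] = (1 + s) ^+ r * (a + b * s) ^+ n.
Proof. by rewrite /rescaled_num !hornerE. Qed.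

(** The reversal k -> 2 m - k turns the sum over k < m for p' into the part
    k > m of the sum for p, with the sign of s ^ (2 m - k) - s ^ k changed, and
    the weight of the middle index k = m is zero.  So the left-hand side is the
    sum of p_k (s ^ (2 m - k) - s ^ k) over all k <= 2 m. *)
Lemma reciprocal_sumB (A : comNzRingType) (m : nat) (p p' : {poly A}) (s : A) :
  reciprocal m.*2 p p' ->
  \sum_(k < m) p`_k * (s ^+ (m.*2 - k) - s ^+ k)
    - \sum_(k < m) p'`_k * (s ^+ (m.*2 - k) - s ^+ k) = p'.[s] - p.[s].
Proof.
case=> szp szp' rpp'.
have split_sum (F : nat -> A) : \sum_(k < m.*2.+1) F k =
    \sum_(k < m) F k + F m + \sum_(k < m) F (m.*2 - k)%N.
  rewrite -addnn -addSn -(big_mkord xpredT) (big_cat_nat (n := m.+1)) //=;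
    last by rewrite ltnS leq_addr.
  rewrite big_mkord big_ord_recr /=; congr (_ + _).
  rewrite -{1}[m.+1]add0n addSn -addnS big_addn.
  rewrite (_ : (m + m.+1 - m.+1 = m)%N); last by lia.
  rewrite big_mkord (reindex_inj rev_ord_inj) /=.
  by apply: eq_bigr => k _; congr (F _); have := ltn_ord k; lia.
rewrite (horner_coef_wide s szp) (horner_coef_wide s szp').
rewrite (split_sum (fun k => p`_k * s ^+ k)).
rewrite (split_sum (fun k => p'`_k * s ^+ k)).
rewrite (rpp' m m) ?addnn //.
have E1 : \sum_(k < m) p`_(m.*2 - k) * s ^+ (m.*2 - k) =
          \sum_(k < m) p'`_k * s ^+ (m.*2 - k).
  by apply: eq_bigr => k _; rewrite (rpp' _ k) //; have := ltn_ord k; lia.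
have E2 : \sum_(k < m) p'`_(m.*2 - k) * s ^+ (m.*2 - k) =
          \sum_(k < m) p`_k * s ^+ (m.*2 - k).
  apply: eq_bigr => k _; rewrite (rpp' k (m.*2 - k)%N) //.
  by have := ltn_ord k; lia.
rewrite E1 E2.
under [\sum_(k < m) p`_k * (_ - _)]eq_bigr => k _ do rewrite mulrBr.
under [\sum_(k < m) p'`_k * (_ - _)]eq_bigr => k _ do rewrite mulrBr.
rewrite !sumrB; ring.
Qed.

Lemma rescaled_num_sumB (A : comNzRingType) (r n m : nat) (a b s : A) :
  (r + n = m.*2)%N ->
  \sum_(k < m) (rescaled_num r n a b)`_k * (s ^+ (m.*2 - k) - s ^+ k)
    - \sum_(k < m) (rescaled_num r n b a)`_k * (s ^+ (m.*2 - k) - s ^+ k) =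
  (1 + s) ^+ r * ((b + a * s) ^+ n - (a + b * s) ^+ n).
Proof.
move=> def_m; rewrite reciprocal_sumB -?def_m; last first.
  exact: reciprocal_rescaled_num.
by rewrite !horner_rescaled_num mulrBr.
Qed.

Lemma coef_comp_scale (A : comNzRingType) (p : {poly A}) (a : A) k :
  (p \Po (a%:P * 'X))`_k = a ^+ k * p`_k.
Proof.
elim/poly_ind: p k => [|p c IHp] k; first by rewrite comp_poly0 !coef0 mulr0.
rewrite comp_poly_MXaddC !coefD mulrA !coefMX !coefMC IHp !coefC mulrDr.
by case: k => [|k] /=; rewrite ?mul1r //= exprS !addr0; ring.
Qed.

(** * Weight polynomials from zeta polynomials *)

Section ZetaWeight.
Variable C : numClosedFieldType.
Implicit Types (q n d m r : nat) (P : {poly C}).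

Definition zeta_kernel q m : {poly C} := geom q%:R m * geom 1 m.

Lemma series_coef_zeta q n m P :
  series_coef (zeta_num n P) (zeta_den C q) m =
    (zeta_num n P * map_poly (@mpolyC 2 C) (zeta_kernel q m))`_m.
Proof.
rewrite /zeta_kernel rmorphM /= !map_geom rmorph_nat rmorph1.
apply: series_coef_truncated_inv; last exact: (zeta_den_inv _ q m).
have -> : (zeta_den C q)`_0 = 1; last exact: unitr1.
by rewrite /zeta_den coef0M !coefB coefMX coefX coef1 /= !subr0 mulr1.
Qed.

(** Expanding (x T + y (1 - T)) ^ n by the binomial formula isolates, for each
    monomial x ^ (n - i) y ^ i, a scalar series divisible by T ^ (n - i), whose
    coefficient in T ^ (n - d) can be nonzero only if i >= d. *)
Lemma zeta_coef_weight_poly q n d P (a : C) : (d <= n)%N ->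
  x C ^+ n + a *: series_coef (zeta_num n P) (zeta_den C q) (n - d) =
  weight_poly n d (fun i => a * 'C(n, i)%:R *
    (P * (1 - 'X) ^+ i * zeta_kernel q (n - d) * 'X^(n - i))`_(n - d)).
Proof.
move=> ledn; rewrite series_coef_zeta /weight_poly; congr (_ + _).
have term i :
    (map_poly (@mpolyC 2 C) P *
       (((x C)%:P * 'X) ^+ (n - i) * ((y C)%:P * (1 - 'X)) ^+ i *+ 'C(n, i)) *
     map_poly (@mpolyC 2 C) (zeta_kernel q (n - d)))`_(n - d) =
    ('C(n, i)%:R *
      (P * (1 - 'X) ^+ i * zeta_kernel q (n - d) * 'X^(n - i))`_(n - d)) *:
      (x C ^+ (n - i) * y C ^+ i).
  transitivity (((x C ^+ (n - i) * y C ^+ i *+ 'C(n, i))%:P *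
    map_poly (@mpolyC 2 C)
      (P * (1 - 'X) ^+ i * zeta_kernel q (n - d) * 'X^(n - i)))`_(n - d)).
    apply: (congr1 (fun p : {poly {mpoly C[2]}} => p`_(n - d))).
    rewrite !rmorphM !rmorphXn !rmorphB !rmorph1 /= !map_polyX polyCMn.
    rewrite !polyCM !polyC_exp !exprMn; ring.
  by rewrite coefCM coef_map /= mulrC mul_mpolyC -scalerMnr scalerMnl mulr_natl.
rewrite /zeta_num addrC exprDn mulr_sumr mulr_suml coef_sum.
under eq_bigr => i _ do rewrite term.
rewrite scaler_sumr -(big_mkord xpredT (fun i => a *: (('C(n, i)%:R *
  (P * (1 - 'X) ^+ i * zeta_kernel q (n - d) * 'X^(n - i))`_(n - d)) *:
    (x C ^+ (n - i) * y C ^+ i)))).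
(* The terms with i < d vanish: they are divisible by T ^ (n - d + 1). *)
rewrite (@big_cat_nat _ _ _ d) ?leqW //= big_nat big1 ?add0r
  => [|i /andP[_ ltid]].
  by apply: eq_bigr => i _; rewrite scalerA mulrA.
by rewrite coefMXn ifT ?mulr0 ?scale0r ?scaler0 //; lia.
Qed.

Lemma act_rescaled_num_sum (M : 'M[C]_2) (r n m : nat) (a b : {mpoly C[2]})
    (c : C) :
  act (\sum_(k < m) (rescaled_num r n a b)`_k *
      (c%:MP ^+ (m.*2 - k) - c%:MP ^+ k)) M
  = \sum_(k < m) (rescaled_num r n (act a M) (act b M))`_k *
      (c%:MP ^+ (m.*2 - k) - c%:MP ^+ k).
Proof.
rewrite /act; move: [tuple _ | _ < 2] => t.
rewrite rmorph_sum; apply: eq_bigr => k _ /=.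
rewrite rmorphM rmorphB !rmorphXn /= comp_mpolyC.
by rewrite -(map_rescaled_num (comp_mpoly t)) coef_map.
Qed.

(** * Invariance when all zeros are at - 1 / sqrt q *)

Variables (q r : nat).
Let s : C := sqrtC q%:R.

Let s_ge0 : 0 <= s.
Proof. by rewrite sqrtC_ge0 ler0n. Qed.

Let s1_neq0 : (1 + s) ^+ r != 0.
Proof. by rewrite expf_neq0 // gt_eqF // ltr_pwDl. Qed.

(** The factor normalizes the value at 1 to be 1; the sum of [reciprocal_sumB]
    then contributes x ^ n with the same coefficient as in the definition of the
    weight polynomial. *)
Definition circle_poly : {poly C} := ((1 + s) ^+ r)^-1 *: (1 + s%:P * 'X) ^+ r.

Definition sigma_x : {mpoly C[2]} := s^-1 *: (x C + (q%:R - 1) *: y C).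
Definition sigma_y : {mpoly C[2]} := s^-1 *: (x C - y C).

Hypothesis q_gt0 : (0 < q)%N.

Let s_neq0 : s != 0.
Proof. by rewrite sqrtC_eq0 pnatr_eq0 -lt0n. Qed.

Lemma add_scale_sigma_y : y C + s *: sigma_y = x C.
Proof. by rewrite /sigma_y scalerA mulfV // scale1r addrC subrK. Qed.

Lemma sigma_y_add_scale : sigma_y + s *: y C = sigma_x.
Proof.
have -> : s *: y C = s^-1 *: (q%:R *: y C).
  by rewrite scalerA -[q%:R]sqrtCK expr2 mulKf.
rewrite -scalerDr /sigma_x scalerBl scale1r; congr (_ *: _).
by rewrite addrA addrAC.
Qed.

(** Since y (1 - T) + x T = y + (x - y) T and x - y = s sigma_y, the variable T
    occurs only through s T. *)
Lemma zeta_num_circle n :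
  zeta_num n circle_poly = (((1 + s) ^+ r)^-1)%:MP%:P *
    (rescaled_num r n (y C) sigma_y \Po (s%:MP%:P * 'X)).
Proof.
rewrite /zeta_num /circle_poly map_polyZ /= -mul_polyC -mulrA; congr (_ * _).
rewrite /rescaled_num rmorphM !rmorphXn !rmorphD rmorph1 !rmorphM /=.
rewrite !map_polyC /= map_polyX comp_polyX !comp_polyC; congr (_ * _ ^+ n).
rewrite mulrA -polyCM mulrC.
rewrite [sigma_y * _]mulrC mul_mpolyC.
have -> : s *: sigma_y = x C - y C.
  by rewrite -[x C in RHS]add_scale_sigma_y addrC addKr.
by rewrite polyCB; ring.
Qed.

(** With q = s ^ 2, the term of index k is
    s ^ k (q ^ (m + 1 - k) - 1) = s ^ (2 (m + 1) - k) - s ^ k. *)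
Lemma zeta_coef_circle n m :
  (q%:R - 1) *: series_coef (zeta_num n circle_poly) (zeta_den C q) m =
  ((1 + s) ^+ r)^-1 *: \sum_(k < m.+1) (rescaled_num r n (y C) sigma_y)`_k *
    (s%:MP ^+ (m.+1.*2 - k) - s%:MP ^+ k).
Proof.
rewrite series_coef_zeta zeta_num_circle -mulrA coefCM mul_mpolyC.
rewrite scalerA mulrC -scalerA coefM scaler_sumr; congr (_ *: _).
apply: eq_bigr => -[k /= ltkm] _.
rewrite coef_map coef_comp_scale /= -mul_mpolyC mulrCA -mpolyCM.
rewrite coef_geomM ?leq_subr // mpolyCB rmorphXn /= mulrAC mulrC; congr (_ * _).
have -> : q%:R = s ^+ 2 by rewrite sqrtCK.
rewrite rmorphXn /= mulrBr mulr1 -exprM -exprD; congr (_ ^+ _ - _); lia.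
Qed.

Lemma act_x : act (x C) (sigma C q) = sigma_x.
Proof.
rewrite /act comp_mpolyXU -tnth_nth tnth_mktuple /sigma !mxE /= mulr1.
by rewrite -scalerA -scalerDr.
Qed.

Lemma act_y : act (y C) (sigma C q) = sigma_y.
Proof.
rewrite /act comp_mpolyXU -tnth_nth tnth_mktuple /sigma !mxE /= mulr1 mulrN1.
by rewrite scaleNr -scalerBr.
Qed.

Lemma act_sigma_y : act sigma_y (sigma C q) = y C.
Proof.
have := act_x; have := act_y; rewrite /act /= => acty actx.
rewrite [in LHS]/sigma_y linearZ linearB /= actx acty.
by rewrite -sigma_y_add_scale addrC addKr scalerA mulVf // scale1r.
Qed.

(** The condition on r says that the middle index of the reversal is the first
    one after n - d, which makes the sum of [zeta_coef_circle] one half of the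
    full range. *)
Lemma act_circle_weight n d : (r + n = (n - d).+1.*2)%N ->
  let W := x C ^+ n +
    (q%:R - 1) *: series_coef (zeta_num n circle_poly) (zeta_den C q) (n - d) in
  act W (sigma C q) = W.
Proof.
move=> def_m W; rewrite /W zeta_coef_circle.
set m := (n - d).+1 in def_m *; set p := rescaled_num r n _ _.
pose p' := rescaled_num r n sigma_y (y C).
have act_sum := act_rescaled_num_sum (sigma C q) r n m (y C) sigma_y s.
rewrite act_y act_sigma_y -/p -/p' in act_sum.
have := rescaled_num_sumB (y C) sigma_y s%:MP def_m.
rewrite ![_ * s%:MP]mulrC !mul_mpolyC sigma_y_add_scale add_scale_sigma_y.
rewrite -/p -/p'.
move/(congr1 (fun S => ((1 + s) ^+ r)^-1 *: S)).
rewrite scalerBr.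
have -> : (1 + s%:MP) ^+ r = ((1 + s) ^+ r)%:MP_[2].
  by rewrite rmorphXn rmorphD rmorph1.
rewrite mul_mpolyC scalerA mulVf // scale1r => defD.
rewrite {1}/act rmorphD rmorphXn /= comp_mpolyZ.
move: act_x act_sum; rewrite /act => -> ->.
have transpose (V : zmodType) (a b u w : V) : a - b = u - w -> u + b = w + a.
  by move/(canRL (subrK _)) ->; rewrite addrA [w + _]addrC subrK.
exact: transpose defD.
Qed.

Lemma size_circle_poly : (size circle_poly <= r.+1)%N.
Proof.
rewrite /circle_poly; apply: leq_trans (size_scale_leq _ _) _.
rewrite -polyC1; elim: r => [|k IHk]; first by rewrite expr0 size_poly1.
by rewrite exprSr size_mul_linear.
Qed.

Lemma coef0_circle_poly_neq0 : circle_poly`_0 != 0.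
Proof.
by rewrite -horner_coef0 /circle_poly !hornerE expr1n mulr1 invr_neq0.
Qed.

Lemma norm_root_circle_poly z : root circle_poly z -> `|z| = s^-1.
Proof.
rewrite /root /circle_poly !hornerE mulf_eq0 invr_eq0 (negPf s1_neq0) /=.
rewrite expf_eq0 => /andP[_]; rewrite addrC addr_eq0 => /eqP sz.
have -> : z = - s^-1 by apply: (mulfI s_neq0); rewrite sz mulrN mulfV.
by rewrite normrN ger0_norm // invr_ge0.
Qed.

End ZetaWeight.

Theorem theorem1p4 (R : realType) (q n d : nat)
    (hq : (2 <= q)%N) (hd : (2 <= d)%N) (hdn : (2 * d <= n + 1)%N) :
  exists (A : nat -> R[i]) (W : {mpoly R[i][2]}),
    [/\ W = weight_poly n d A,
        A d != 0,
        act W (sigma R[i] q) = W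
      & riemann_hypothesis q n d W].
Proof.
have q_gt0 : (0 < q)%N by apply: ltnW.
have q1_neq0 : q%:R - 1 != 0 :> R[i].
  by rewrite subr_eq0 -[1]/(1%:R) eqr_nat gtn_eqF.
have ledn : (d <= n)%N by lia.
pose r := (n + 2 - 2 * d)%N; pose P := circle_poly R[i] q r.
exists (fun i => (q%:R - 1) * 'C(n, i)%:R *
  (P * (1 - 'X) ^+ i * zeta_kernel R[i] q (n - d) * 'X^(n - i))`_(n - d)).
exists (x R[i] ^+ n +
  (q%:R - 1) *: series_coef (zeta_num n P) (zeta_den R[i] q) (n - d)).
split.
- exact: zeta_coef_weight_poly.
- rewrite coefMXn ltnn subnn !coef0M.
  have -> : ((1 - 'X) ^+ d : {poly R[i]})`_0 = 1.
    by rewrite -horner_coef0 !hornerE subr0 expr1n.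
  rewrite !coef_poly !expr0 !mulr1.
  rewrite !mulf_neq0 ?pnatr_eq0 -?lt0n ?bin_gt0 //.
  exact: coef0_circle_poly_neq0.
- by apply: act_circle_weight => //; rewrite /r; lia.
- exists P; split; last exact: norm_root_circle_poly.
  split; first by apply: leq_trans (size_circle_poly _ _ _) _; rewrite /r; lia.
  by rewrite [x _ ^+ n + _]addrC addrK scalerA mulVf // scale1r.
Qed.
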